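(* Let $\{A,B\}$ be an adjoint pair of densely defined operators on a Hilbert space $\mathcal{H}$ such that $0$ is a regular point for $A$ and for $B$. Let $R$ be the associated closed operator with the properties listed in the context. Let $\mathfrak{A}$ be the symmetric operator on $\mathcal{H}\oplus\mathcal{H}$ with domain $\mathcal{D}(\mathfrak{A})=\mathcal{D}(B)\oplus\mathcal{D}(A)$ given by $\mathfrak{A}(x,y)=(Ay,Bx)$; its adjoint $\mathfrak{A}^*$ has domain $\mathcal{D}(\mathfrak{A}^* )=\mathcal{D}(A^* )\oplus\mathcal{D}(B^* )$ and acts by $\mathfrak{A}^*(x,y)=(B^*y,A^*x)$. Let $\mathcal{K}=\mathcal{N}(A^* )\oplus\mathcal{N}(B^* )$ be the Hilbert space with scalar product $((u,v),(u',v'))=\langle u,u'\rangle+\langle v,v'\rangle$. Define linear mappings $\Gamma_0,\Gamma_1:\mathcal{D}(\mathfrak{A}^* )\to\mathcal{K}$ by $$\Gamma_0(x,y)=(u_1,v_1),\qquad \Gamma_1(x,y)=(u_2,-v_2),$$ where $x\in\mathcal{D}(A^* )$ and $y\in\mathcal{D}(B^* )$ are uniquely written as $x=x_0+(R^* )^{-1}v_1+u_1$ and $y=y_0+R^{-1}u_2+v_2$ with $x_0\in\mathcal{D}(B)$, $y_0\in\mathcal{D}(A)$, $u_1,u_2\in\mathcal{N}(A^* )$, $v_1,v_2\in\mathcal{N}(B^* )$. Then $(\mathcal{K},\Gamma_0,\Gamma_1)$ is a boundary triplet for $\mathfrak{A}^*$.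
   Context: $\mathcal{D}(T)$ and $\mathcal{N}(T)$ denote the domain and the kernel of an operator $T$; $\dot{+}$ denotes the direct sum of vector spaces; $\mathbf{B}(\mathcal{H})$ denotes the bounded operators on $\mathcal{H}$. An adjoint pair $\{A,B\}$ is a pair of densely defined linear operators on $\mathcal{H}$ with $\langle Ax,y\rangle=\langle x,By\rangle$ for $x\in\mathcal{D}(A)$, $y\in\mathcal{D}(B)$; equivalently $A\subseteq B^*$ and $B\subseteq A^*$. The number $0$ is a regular point for an operator $T$ if there is $\gamma>0$ with $\|T\varphi\|\ge\gamma\|\varphi\|$ for all $\varphi\in\mathcal{D}(T)$. Associated operator $R$: throughout, $R$ is a fixed closed operator on $\mathcal{H}$ such that $R$ and $R^*$ have inverses $R^{-1},(R^* )^{-1}\in\mathbf{B}(\mathcal{H})$, $A\subseteq R\subseteq B^*$, $B\subseteq R^*\subseteq A^*$, and $$\mathcal{D}(A^* )=\mathcal{D}(B)\dot{+}(R^* )^{-1}\mathcal{N}(B^* )\dot{+}\mathcal{N}(A^* ),\qquad \mathcal{D}(B^* )=\mathcal{D}(A)\dot{+}R^{-1}\mathcal{N}(A^* )\dot{+}\mathcal{N}(B^* ).$$ (Such an $R$ is supplied by a theorem of Vishik.) Then $A^*(x_0+(R^* )^{-1}v+u)=Bx_0+v$ and $B^*(y_0+R^{-1}u+v)=Ay_0+u$ for $x_0\in\mathcal{D}(B)$, $y_0\in\mathcal{D}(A)$, $u\in\mathcal{N}(A^* )$, $v\in\mathcal{N}(B^* )$. Boundary triplet: let $T$ be a densely defined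 symmetric operator on a Hilbert space. A boundary triplet for $T^*$ is a triplet $(\mathcal{K},\Gamma_0,\Gamma_1)$ of a Hilbert space $(\mathcal{K},(\cdot,\cdot))$ and linear mappings $\Gamma_0,\Gamma_1:\mathcal{D}(T^* )\to\mathcal{K}$ such that (i) $\langle T^*x,y\rangle-\langle x,T^*y\rangle=(\Gamma_1x,\Gamma_0y)-(\Gamma_0x,\Gamma_1y)$ for all $x,y\in\mathcal{D}(T^* )$, and (ii) the mapping $x\mapsto(\Gamma_0x,\Gamma_1x)$ from $\mathcal{D}(T^* )$ to $\mathcal{K}\oplus\mathcal{K}$ is surjective. *)

(* Defs.v *)
From HB Require Import structures.
From mathcomp Require Import all_boot all_order all_algebra sesquilinear.
From mathcomp Require Import complex.
From mathcomp Require Import all_classical all_reals all_analysis.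

Set Implicit Arguments.
Unset Strict Implicit.
Unset Printing Implicit Defensive.

Import Order.TTheory GRing.Theory Num.Theory.
Import numFieldNormedType.Exports.

Local Open Scope classical_set_scope.
Local Open Scope ring_scope.

(** A Hilbert space over C is a complete normed module whose norm
    comes from an inner product. The inner product is linear in the first
    argument and conjugate-linear in the second. *)
HB.mixin Record CompleteNormedModule_isHilbert (C : numClosedFieldType) H
    & CompleteNormedModule C H := {
  inner_subproof : {dot H for Num.conj};
  normr_inner_subproof : forall x : H,
    `|x| = sqrtC (inner_subproof x x)
}.

#[short(type="hilbertType")]
HB.structure Definition Hilbert (C : numClosedFieldType) :=
  {H of CompleteNormedModule C H & CompleteNormedModule_isHilbert C H}.

Definition inner {C : numClosedFieldType} {H : hilbertType C} :
  {dot H for Num.conj} := inner_subproof.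

Notation "'[ x , y ]" := (inner x y) : ring_scope.

Lemma normr_inner (C : numClosedFieldType) (H : hilbertType C) (x : H) :
  `|x| = sqrtC '[x, x].
Proof. exact: normr_inner_subproof. Qed.

Section PreHilbert.
Variables (C : numClosedFieldType) (U : lmodType C) (f : {dot U for Num.conj}).

Lemma dot_CauchySchwarz u v : `|f u v| ^+ 2 <= f u u * f v v.
Proof.
have [->|v0] := eqVneq v 0.
  by rewrite !linear0r normr0 expr0n ?mulr0.
have fv : 0 < f v v by exact: neq0_dnorm_gt0.
have fvr : (f v v)^* = f v v by apply/CrealP/gtr0_real.
have : 0 <= f (f v v *: u - f u v *: v) (f v v *: u - f u v *: v).
  exact: dnorm_ge0.
rewrite linearBl !linearBr/= !linearZl_LR/= !linearZr_LR/= fvr.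
rewrite [f v u]hermC expr0 mul1r.
rewrite [X in 0 <= X](_ : _ = f v v * (f u u * f v v - `|f u v| ^+ 2)).
  by rewrite pmulr_rge0// subr_ge0.
rewrite normCK mulrBr.
set a := f u u; set b := f v v; set c := f u v; set d := c^*.
rewrite /GRing.scale/= -/c -/d (mulrC c b) opprB addrA subrK mulrA.
by rewrite -mulrA (mulrC a b).
Qed.

Lemma dot_ler_normD u v :
  sqrtC (f (u + v) (u + v)) <= sqrtC (f u u) + sqrtC (f v v).
Proof.
rewrite -(@ler_pXn2r _ 2)// ?nnegrE ?addr_ge0 ?sqrt_dnorm_ge0//.
rewrite sqrtCK sqrrD !sqrtCK dnormD/= addrAC lerD2r lerD2l.
rewrite -mulr_natl; set c := f u v.
have -> : c + c^* = 2 * 'Re c by rewrite ReE mulrC divfK ?pnatr_eq0.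
rewrite ler_pM2l ?ltr0n//.
apply: (@le_trans _ _ `|c|).
  exact: (leif_Re_Creal c).1.
rewrite -(@ler_pXn2r _ 2)// ?nnegrE ?mulr_ge0 ?sqrt_dnorm_ge0//.
by rewrite exprMn !sqrtCK dot_CauchySchwarz.
Qed.

Lemma dot_normrZ (a : C) u :
  sqrtC (f (a *: u) (a *: u)) = `|a| * sqrtC (f u u).
Proof.
by rewrite dnormZ sqrtCM ?nnegrE ?exprn_ge0 ?dnorm_ge0// sqrCK.
Qed.

Lemma dot_normr0_eq0 u : sqrtC (f u u) = 0 -> u = 0.
Proof. by move=> /eqP; rewrite sqrt_dnorm_eq0 => /eqP. Qed.

End PreHilbert.

(** Builds the norm and the topology from an inner product alone; completeness is
    stated for filters, as in the library. *)
HB.factory Record Lmodule_isHilbert (C : numClosedFieldType) H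
    & GRing.Lmodule C H := {
  dot : {dot H for Num.conj};
  dot_complete : forall F : set_system H, ProperFilter F ->
    (forall e : C, 0 < e ->
       exists x, F [set y | sqrtC (dot (x - y) (x - y)) < e]) ->
    exists l, forall e : C, 0 < e ->
       F [set y | sqrtC (dot (l - y) (l - y)) < e]
}.

HB.builders Context C H & Lmodule_isHilbert C H.

HB.instance Definition _ := @Lmodule_isNormed.Build C H
  (fun x => sqrtC (dot x x)) (@dot_ler_normD _ _ dot) (@dot_normrZ _ _ dot)
  (@dot_normr0_eq0 _ _ dot).

Let cauchy_cvg_ (F : set_system H) : ProperFilter F -> cauchy F -> cvg F.
Proof.
move=> FF /cauchyP Fc.
have [|l Fl] := dot_complete FF.
  move=> e e0; have [x] := Fc _ e0.
  by rewrite -ball_normE/= => ?; exists x.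
by apply/cvg_ex; exists l; apply/cvgrPdist_lt => e e0; exact: Fl.
Qed.

HB.instance Definition _ := Uniform_isComplete.Build H cauchy_cvg_.

HB.instance Definition _ :=
  @CompleteNormedModule_isHilbert.Build C H dot (fun=> erefl).

HB.end.

Lemma inner_le (C : numClosedFieldType) (H : hilbertType C) (x y : H) :
  `|'[x, y]| <= `|x| * `|y|.
Proof.
rewrite -(@ler_pXn2r _ 2)// ?nnegrE ?mulr_ge0// exprMn !normr_inner !sqrtCK.
exact: dot_CauchySchwarz.
Qed.

Lemma dense_inner0 (C : numClosedFieldType) (H : hilbertType C) (D : set H)
  (z : H) : dense D -> (forall x, D x -> '[x, z] = 0) -> z = 0.
Proof.
move=> dD Dz; apply/eqP; apply: contraT => z0.
have z_gt0 : 0 < `|z| by rewrite normr_gt0.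
have [||x [zx Dx]] := dD (ball z `|z|); first by exists z; exact: ballxx.
  exact: ball_open.
move: zx; rewrite -ball_normE/= => zx.
suff : `|z| * `|z| < `|z| * `|z| by rewrite ltxx.
have zz : '[z, z] = `|z| * `|z| by rewrite -expr2 normr_inner sqrtCK.
have {1}<- : `|'[z - x, z]| = `|z| * `|z|.
  by rewrite linearBl/= (Dz x Dx) subr0 zz ger0_norm// mulr_ge0.
by rewrite (le_lt_trans (inner_le _ _))// ltr_pM2r.
Qed.

(** The orthogonal sum of Hilbert spaces: the library's topology on a product
    comes from the maximum norm, hence a distinct name for the carrier. *)
Definition hsum (H K : Type) : Type := (H * K)%type.

Section Hsum.
Variables (C : numClosedFieldType) (H K : hilbertType C).

HB.instance Definition _ := GRing.Lmodule.copy (hsum H K) (H * K)%type.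

Definition hsum_dot (p q : hsum H K) : C := '[p.1, q.1] + '[p.2, q.2].

Let hsum_dot_bilinear :
  bilinear_for (GRing.Scale.Law.clone _ _ ( *%R ) _)
    (GRing.Scale.Law.clone _ _ (Num.conj \; *%R ) _) hsum_dot.
Proof.
split=> [q a p p'|p a q q']; rewrite /hsum_dot/=.
  by rewrite !linearPl/= mulrDr addrACA.
by rewrite !linearPr/= mulrDr addrACA.
Qed.

HB.instance Definition _ := bilinear_isBilinear.Build C (hsum H K) (hsum H K) C
  _ _ hsum_dot hsum_dot_bilinear.

Let hsum_dotC (p q : hsum H K) :
  hsum_dot p q = (-1) ^+ false * Num.conj (hsum_dot q p).
Proof.
rewrite /hsum_dot expr0 mul1r rmorphD/=.
by congr (_ + _); rewrite [LHS]hermC expr0 mul1r.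
Qed.

HB.instance Definition _ := isHermitianSesquilinear.Build C (hsum H K) false
  Num.conj hsum_dot hsum_dotC.

Let hsum_dot_gt0 (p : hsum H K) : p != 0 -> 0 < hsum_dot p p.
Proof.
case: p => x y; rewrite xpair_eqE negb_and /hsum_dot/= => /orP[x0|y0].
  by rewrite ltr_pwDl ?dnorm_gt0// dnorm_ge0.
by rewrite ltr_wpDl ?dnorm_gt0// dnorm_ge0.
Qed.

HB.instance Definition _ := isDotProduct.Build C (hsum H K) hsum_dot hsum_dot_gt0.

Let hsum_dot_ge (p : hsum H K) :
  `|p.1| <= sqrtC (hsum_dot p p) /\ `|p.2| <= sqrtC (hsum_dot p p).
Proof.
by split; rewrite -(@ler_pXn2r _ 2)// ?nnegrE ?sqrt_dnorm_ge0// sqrtCK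
  normr_inner sqrtCK ?lerDl ?lerDr dnorm_ge0.
Qed.

Let hsum_dot_le (p : hsum H K) : sqrtC (hsum_dot p p) <= `|p.1| + `|p.2|.
Proof.
rewrite -(@ler_pXn2r _ 2)// ?nnegrE ?addr_ge0 ?sqrt_dnorm_ge0// sqrtCK sqrrD.
rewrite !normr_inner !sqrtCK addrAC lerDl mulrn_wge0// mulr_ge0//.
  exact: sqrt_dnorm_ge0.
exact: sqrt_dnorm_ge0.
Qed.

Let hsum_complete (F : set_system (hsum H K)) : ProperFilter F ->
  (forall e : C, 0 < e ->
     exists x, F [set y | sqrtC (hsum_dot (x - y) (x - y)) < e]) ->
  exists l, forall e : C, 0 < e ->
     F [set y | sqrtC (hsum_dot (l - y) (l - y)) < e].
Proof.
move=> FF Fc.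
have F1 : cauchy ((fst : hsum H K -> H) @ F).
  apply/cauchyP => e /Fc[p Fp]; exists p.1; apply: (@filterS _ F _ _ _ _ Fp) => q /=.
  by rewrite -ball_normE/=; apply: le_lt_trans; exact: (hsum_dot_ge (p - q)).1.
have F2 : cauchy ((snd : hsum H K -> K) @ F).
  apply/cauchyP => e /Fc[p Fp]; exists p.2; apply: (@filterS _ F _ _ _ _ Fp) => q /=.
  by rewrite -ball_normE/=; apply: le_lt_trans; exact: (hsum_dot_ge (p - q)).2.
have /cauchy_cvg/cvg_ex[l1 Fl1] := F1.
have /cauchy_cvg/cvg_ex[l2 Fl2] := F2.
exists (l1, l2) => e e0.
have e20 : 0 < e / 2 by rewrite divr_gt0.
near=> q; rewrite /= (le_lt_trans (hsum_dot_le _))// (splitr e) ltrD//=.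
  by near: q; move/cvgrPdist_lt : Fl1; exact.
by near: q; move/cvgrPdist_lt : Fl2; exact.
Unshelve. all: by end_near. Qed.

HB.instance Definition _ :=
  @Lmodule_isHilbert.Build C (hsum H K) hsum_dot hsum_complete.

Lemma inner_hsum (p q : hsum H K) : '[p, q] = '[p.1, q.1] + '[p.2, q.2].
Proof. by []. Qed.

Lemma normr_hsum_le (p : hsum H K) : `|p| <= `|p.1| + `|p.2|.
Proof. exact: hsum_dot_le. Qed.

End Hsum.

(** Linear subspaces; through [subspace_type] a subspace is itself an lmodType. *)
Record lin_subspace (C : numClosedFieldType) (H : lmodType C) := Subspace {
  carrier : set H;
  carrier0 : carrier 0;
  carrierPl : forall (a : C) x y, carrier x -> carrier y -> carrier (a *: x + y)
}.

Definition sub_pred (C : numClosedFieldType) (H : lmodType C) (V : lin_subspace H)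
  : {pred H} := fun x => `[< carrier V x >].

Record subspace_type (C : numClosedFieldType) (H : lmodType C) (V : lin_subspace H) :=
  SubType { sub_val : H; sub_valP : sub_pred V sub_val }.

Coercion subspace_type : lin_subspace >-> Sortclass.

Section SubType.
Variables (C : numClosedFieldType) (H : lmodType C) (V : lin_subspace H).

Let sub_pred_submod : submod_closed (sub_pred V).
Proof.
split=> [|a x y]; first by apply/asboolP; exact: carrier0.
by move=> /asboolP Vx /asboolP Vy; apply/asboolP; exact: carrierPl.
Qed.

HB.instance Definition _ := GRing.isSubmodClosed.Build C H (sub_pred V)
  sub_pred_submod.

HB.instance Definition _ := [isSub for @sub_val C H V].
HB.instance Definition _ := [Choice of subspace_type V by <:].
HB.instance Definition _ :=
  [SubChoice_isSubLmodule of subspace_type V by <:].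

Lemma carrier_val (x : V) : carrier V (\val x).
Proof. exact/asboolP/(sub_valP x). Qed.

Lemma sub_valPl (a : C) (x y : V) :
  \val (a *: x + y) = a *: (\val x : H) + \val y.
Proof. exact: (linearP (\val : V -> H)). Qed.

Definition inV (x : H) (Vx : carrier V x) : V := SubType (asboolT Vx).

End SubType.

Record closed_subspace (C : numClosedFieldType) (H : hilbertType C) :=
  ClosedSubspace {
    csub :> lin_subspace H;
    closed_csub : closed (carrier csub)
  }.

Section ClosedSubspace.
Variables (C : numClosedFieldType) (H : hilbertType C).
Variable V : closed_subspace H.

Definition sub_dot (x y : csub V) : C := '[\val x : H, \val y : H].

Let sub_dot_bilinear :
  bilinear_for (GRing.Scale.Law.clone _ _ ( *%R ) _)
    (GRing.Scale.Law.clone _ _ (Num.conj \; *%R ) _) sub_dot.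
Proof.
split=> [y a x x'|x a y y']; rewrite /sub_dot.
  by rewrite sub_valPl linearPl.
by rewrite sub_valPl linearPr.
Qed.

HB.instance Definition _ := bilinear_isBilinear.Build C _ _ C
  _ _ sub_dot sub_dot_bilinear.

Let sub_dotC (x y : csub V) :
  sub_dot x y = (-1) ^+ false * Num.conj (sub_dot y x).
Proof. exact: hermC. Qed.

HB.instance Definition _ := isHermitianSesquilinear.Build C _ false
  Num.conj sub_dot sub_dotC.

Let sub_dot_gt0 (x : csub V) : x != 0 -> 0 < sub_dot x x.
Proof.
move=> x0; rewrite /sub_dot dnorm_gt0; apply: contra x0 => /eqP x0.
by apply/eqP/val_inj; rewrite x0 linear0.
Qed.

HB.instance Definition _ := isDotProduct.Build C _ sub_dot sub_dot_gt0.

Let sub_complete (F : set_system (csub V)) : ProperFilter F ->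
  (forall e : C, 0 < e ->
     exists x, F [set y | sqrtC (sub_dot (x - y) (x - y)) < e]) ->
  exists l, forall e : C, 0 < e ->
     F [set y | sqrtC (sub_dot (l - y) (l - y)) < e].
Proof.
move=> FF Fc.
have Fv : cauchy ((\val : csub V -> H) @ F).
  apply/cauchyP => e /Fc[x Fx]; exists (\val x); apply: (@filterS _ F _ _ _ _ Fx) => y /=.
  by rewrite -ball_normE/= normr_inner /sub_dot linearB.
have /cauchy_cvg/cvg_ex[l Fl] := Fv.
have Vl : carrier V l.
  apply: closed_csub => B /Fl FB.
  by have [x Bx] := @filter_ex _ F _ (\val @^-1` B) FB; exists (\val x); split=> //; exact: carrier_val.
exists (inV Vl) => e e0; move/cvgrPdist_lt : Fl => /(_ _ e0).
by apply: filterS => y; rewrite /= normr_inner /sub_dot linearB.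
Qed.

HB.instance Definition _ :=
  @Lmodule_isHilbert.Build C (subspace_type (csub V)) sub_dot sub_complete.

Lemma inner_sub (x y : csub V) : '[x, y] = '[\val x : H, \val y : H].
Proof. by []. Qed.

End ClosedSubspace.

(** An unbounded operator: a linear map on a linear subspace, its domain. *)
Record linop (C : numClosedFieldType) (H : hilbertType C) := Linop {
  dom : lin_subspace H;
  linop_fun :> {linear dom -> H}
}.

Record dense_linop (C : numClosedFieldType) (H : hilbertType C) := DenseLinop {
  dense_linop_val :> linop H;
  dense_dom : dense (carrier (dom dense_linop_val))
}.

Section Operators.
Variables (C : numClosedFieldType) (H : hilbertType C).
Implicit Types S T : linop H.

(** The inclusion of operators: [T] is an extension of [S]. *)
Definition extends S T := forall x : dom S,
  exists2 y : dom T, \val y = \val x :> H & T y = S x.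

Definition closed_op T :=
  closed [set p : H * H | exists x : dom T, p = (\val x, T x)].

(** The number 0 is a regular point for [T]. *)
Definition regular0 T := exists2 c : C, 0 < c &
  forall x : dom T, c * `|\val x : H| <= `|T x|.

Definition adjoint_pair S T := forall (x : dom S) (y : dom T),
  '[S x, \val y : H] = '[\val x : H, T y].

Definition symmetric_op T := adjoint_pair T T.

(** [V] is the everywhere defined bounded inverse of [T]; for a linear map,
    bounded means continuous. *)
Definition bounded_inverse T (V : {linear H -> H}) :=
  [/\ continuous V,
      (forall y, exists2 x : dom T, \val x = V y & T x = y) &
      (forall x : dom T, V (T x) = \val x)].

(** [D] is the algebraic direct sum of [U], [V] and [W]. *)
Definition direct_sum3 (D U V W : set H) :=
  D = [set x | exists u v w, [/\ U u, V v, W w & x = u + v + w]] /\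
  forall u v w, U u -> V v -> W w -> u + v + w = 0 -> [/\ u = 0, v = 0 & w = 0].

Lemma nullspace_subproof T (a : C) x y :
  (exists2 z : dom T, \val z = x & T z = 0) ->
  (exists2 z : dom T, \val z = y & T z = 0) ->
  exists2 z : dom T, \val z = a *: x + y & T z = 0.
Proof.
move=> [u <- Tu] [v <- Tv]; exists (a *: u + v); first exact: sub_valPl.
by rewrite linearP Tu Tv scaler0 addr0.
Qed.

Lemma nullspace0_subproof T : exists2 z : dom T, \val z = 0 & T z = 0.
Proof. by exists 0; rewrite ?linear0. Qed.

Definition nullspace T : lin_subspace H :=
  @Subspace C H [set x | exists2 z : dom T, \val z = x & T z = 0]
    (nullspace0_subproof T) (@nullspace_subproof T).

Section Adjoint.
Variable T : dense_linop H.

Definition adjoint_rel (y z : H) :=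
  forall x : dom T, '[T x, y] = '[\val x : H, z].

Lemma adjoint_rel_uniq y z z' : adjoint_rel y z -> adjoint_rel y z' -> z = z'.
Proof.
move=> yz yz'; apply/eqP; rewrite -subr_eq0; apply/eqP.
apply: (dense_inner0 (@dense_dom _ _ T)) => x Dx.
by rewrite linearBr/= -(yz (inV Dx)) -(yz' (inV Dx)) subrr.
Qed.

Lemma adjoint_relPl (a : C) y z y' z' : adjoint_rel y z -> adjoint_rel y' z' ->
  adjoint_rel (a *: y + y') (a *: z + z').
Proof. by move=> yz yz' x; rewrite !linearPr/= yz yz'. Qed.

Lemma adjoint_dom0 : exists z, adjoint_rel 0 z.
Proof. by exists 0 => x; rewrite !linear0r. Qed.

Lemma adjoint_domPl (a : C) y y' : (exists z, adjoint_rel y z) ->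
  (exists z, adjoint_rel y' z) -> exists z, adjoint_rel (a *: y + y') z.
Proof.
by move=> [z yz] [z' yz']; exists (a *: z + z'); exact: adjoint_relPl.
Qed.

Definition adjoint_dom : lin_subspace H :=
  @Subspace C H [set y | exists z, adjoint_rel y z] adjoint_dom0 adjoint_domPl.

(** The choice is harmless: since [T] is densely defined, [adjoint_rel_uniq]
    leaves only one candidate. *)
Definition adjoint_fun (y : adjoint_dom) : H := projT1 (cid (carrier_val y)).

Lemma adjoint_funP (y : adjoint_dom) : adjoint_rel (\val y) (adjoint_fun y).
Proof. exact: projT2 (cid _). Qed.

Let adjoint_fun_linear : linear adjoint_fun.
Proof.
move=> a y y'; apply: (@adjoint_rel_uniq (\val (a *: y + y'))).
  exact: adjoint_funP.
by rewrite sub_valPl; apply: adjoint_relPl; exact: adjoint_funP.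
Qed.

HB.instance Definition _ :=
  GRing.isLinear.Build C adjoint_dom H _ adjoint_fun adjoint_fun_linear.

Definition adjoint : linop H := Linop (adjoint_fun : {linear _ -> _}).

Lemma closed_nullspace_adjoint : closed (carrier (nullspace adjoint)).
Proof.
have kerE y : carrier (nullspace adjoint) y <-> adjoint_rel y 0.
  split=> [[z <- z0]|y0]; first by rewrite -z0; exact: adjoint_funP.
  have Dy : carrier adjoint_dom y by exists 0.
  exists (inV Dy) => //; apply: (@adjoint_rel_uniq y _ 0) => //.
  exact: (adjoint_funP (inV Dy)).
move=> y cy; apply/kerE => x; rewrite linear0r; apply/eqP; apply: contraT => c0.
have Tx0 : 0 < `|T x|.
  by rewrite normr_gt0; apply: contra c0 => /eqP->; rewrite linear0l.
have e0 : 0 < `|'[T x, y]| / `|T x| by rewrite divr_gt0// normr_gt0.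
have [w [/kerE/(_ x) + ]] := cy _ (nbhsx_ballx y _ e0).
rewrite linear0r -ball_normE/= => Tw.
rewrite ltr_pdivlMr// => yw.
have : `|'[T x, y]| <= `|T x| * `|y - w|.
  by rewrite (le_trans _ (inner_le _ _))// linearBr/= Tw subr0.
by move/(lt_le_trans yw); rewrite mulrC ltxx.
Qed.

(** Makes [nullspace (adjoint T)] a hilbertType with the inherited inner product. *)
Canonical nullspace_adjoint : closed_subspace H :=
  ClosedSubspace closed_nullspace_adjoint.

End Adjoint.

End Operators.

(** The operator (x, y) |-> (A y, B x) on the orthogonal sum, with domain the
    pairs (x, y) such that x is in the domain of B and y in that of A. *)
Section Offdiag.
Variables (C : numClosedFieldType) (H : hilbertType C) (A B : dense_linop H).

Let offdiag_set : set (hsum H H) :=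
  [set p | carrier (dom B) p.1 /\ carrier (dom A) p.2].

Let offdiag0 : offdiag_set 0.
Proof. by split; exact: carrier0. Qed.

Let offdiagPl (a : C) p q :
  offdiag_set p -> offdiag_set q -> offdiag_set (a *: p + q).
Proof. by move=> [? ?] [? ?]; split; exact: carrierPl. Qed.

Definition offdiag_dom : lin_subspace (hsum H H) := Subspace offdiag0 offdiagPl.

Definition offdiag1 (p : offdiag_dom) : dom B := inV (carrier_val p).1.
Definition offdiag2 (p : offdiag_dom) : dom A := inV (carrier_val p).2.

Definition offdiag_fun (p : offdiag_dom) : hsum H H :=
  (A (offdiag2 p), B (offdiag1 p)).

Let offdiag_fun_linear : linear offdiag_fun.
Proof.
move=> a p q.
have -> : offdiag_fun (a *: p + q) =
    (A (a *: offdiag2 p + offdiag2 q), B (a *: offdiag1 p + offdiag1 q)).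
  by congr ((A _, B _)); apply/val_inj; rewrite sub_valPl.
by rewrite !linearP.
Qed.

HB.instance Definition _ := GRing.isLinear.Build C offdiag_dom (hsum H H) _
  offdiag_fun offdiag_fun_linear.

Let dense_offdiag : dense (carrier offdiag_dom).
Proof.
move=> O [p Op] oO.
have : nbhs p O by exact: open_nbhs_nbhs.
move=> /nbhs_ballP[e /= e0 eO].
have e20 : 0 < e / 2 by rewrite divr_gt0.
have [||x [px Bx]] := @dense_dom _ _ B (ball p.1 (e / 2)).
- by exists p.1; exact: ballxx.
- exact: ball_open.
have [||y [py Ay]] := @dense_dom _ _ A (ball p.2 (e / 2)).
- by exists p.2; exact: ballxx.
- exact: ball_open.
exists (x, y); split; last by [].
apply: eO; move: px py; rewrite -!ball_normE/= => px py.
rewrite (splitr e) (le_lt_trans (normr_hsum_le _))// ltrD//.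
Qed.

Definition offdiag : dense_linop (hsum H H) :=
  @DenseLinop _ _ (Linop (offdiag_fun : {linear _ -> _})) dense_offdiag.

End Offdiag.

(** A boundary triplet (K, G0, G1) for the adjoint of [T]. *)
Record boundary_triplet (C : numClosedFieldType) (H : hilbertType C)
    (T : dense_linop H) (K : hilbertType C)
    (G0 G1 : dom (adjoint T) -> K) : Prop := {
  triplet_linear0 : linear G0;
  triplet_linear1 : linear G1;
  triplet_green : forall x y : dom (adjoint T),
    '[adjoint T x, \val y : H] - '[\val x : H, adjoint T y] =
    '[G1 x, G0 y] - '[G0 x, G1 y];
  triplet_surj : forall k0 k1 : K, exists x, G0 x = k0 /\ G1 x = k1
}.

Section Gamma.
Variables (C : numClosedFieldType) (H : hilbertType C) (A B : dense_linop H).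
Variables (Ri Rsi : H -> H).

Local Notation NA := (nullspace (adjoint A)).
Local Notation NB := (nullspace (adjoint B)).

(** [c] stands for ((u1, v1), (u2, v2)); the remaining components x0 and y0 are
    then determined by [p]. *)
Definition decomposition (p : hsum H H) (c : (NA * NB) * (NA * NB)) :=
  exists (x0 : dom B) (y0 : dom A),
    p.1 = \val x0 + Rsi (\val c.1.2) + \val c.1.1 /\
    p.2 = \val y0 + Ri (\val c.2.1) + \val c.2.2.

(** The value 0 is used only when [p] has no decomposition. *)
Definition components (p : hsum H H) : (NA * NB) * (NA * NB) :=
  xget 0 [set c | decomposition p c].

Definition Gamma0 (p : dom (adjoint (offdiag A B))) : hsum NA NB :=
  let: ((u1, v1), _) := components (\val p) in (u1, v1).

Definition Gamma1 (p : dom (adjoint (offdiag A B))) : hsum NA NB :=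
  let: (_, (u2, v2)) := components (\val p) in (u2, - v2).

End Gamma.

Arguments decomposition {C H} A B Ri Rsi p c.
Arguments Gamma0 {C H} A B Ri Rsi p.
Arguments Gamma1 {C H} A B Ri Rsi p.

(* Main.v *)
Require Import Defs.
From mathcomp Require Import all_boot all_order all_algebra complex.
From mathcomp Require Import ring.
From mathcomp Require Import all_classical all_reals all_analysis.

Set Implicit Arguments.
Unset Strict Implicit.
Unset Printing Implicit Defensive.

Import Order.TTheory GRing.Theory Num.Theory.
Import numFieldNormedType.Exports.

Local Open Scope classical_set_scope.
Local Open Scope ring_scope.

(** The adjoint of the off-diagonal operator is off-diagonal again, with entries
    [adjoint B] and [adjoint A] ([offdiag_adjoint_relP]), so everything reduces
    to the adjoint pair. Write S* and T* for the adjoints of a pair S, T, and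
    let W and V be right inverses of S* and T* that are adjoint to each other.
    On x = x0 + W v1 + u1 and y = y0 + V u2 + v2, with x0 and y0 in the domains
    of T and S and with u1 and v2 in the kernels of S* and T*, one has
    S* x = T x0 + v1 and T* y = S y0 + u2. Expanding, all terms that contain x0
    or y0 cancel by adjointness and the terms <v1, V u2> and <W v1, u2> cancel
    each other, which leaves ([green_adjoint_pair])

      <S* x, y> - <x, T* y> = <v1, v2> - <u1, u2>.

    For p = (x, y) and p' = (x', y'), Green's identity is this formula for
    (x, y') minus the complex conjugate of the formula for (x', y); the sign in
    the second entry of [Gamma1] makes the result equal to
    <Gamma1 p, Gamma0 p'> - <Gamma0 p, Gamma1 p'>.

    The components are unique, because the sums are direct and a right inverse
    is injective ([direct_sum_coordinates_inj]). Hence they depend linearly on p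
    ([components_linear]). Surjectivity is immediate: every choice of
    u1, v1, u2, v2 occurs already with x0 = y0 = 0. *)

(** * Adjoint graphs *)

Section AdjointGraph.
Variables (C : numClosedFieldType) (H : hilbertType C).
Implicit Types S T : dense_linop H.

Lemma inner_conj (x y : H) : '[x, y] = ('[y, x])^*.
Proof. by rewrite [LHS]hermC expr0 mul1r. Qed.

(** [adjoint_rel T] is the graph of the adjoint as a relation on vectors; it is
    used below in place of applications of [adjoint T], which require a
    membership proof for each vector. *)
Lemma adjoint_graphP T (y z : H) : adjoint_rel T y z <->
  exists2 d : dom (adjoint T), \val d = y & adjoint T d = z.
Proof.
split=> [yz|[d <- <-]]; last exact: adjoint_funP.
have Dy : carrier (dom (adjoint T)) y by exists z.
exists (inV Dy) => //; apply: (adjoint_rel_uniq _ yz).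
exact: (adjoint_funP (inV Dy)).
Qed.

Lemma adjoint_eq T (d : dom (adjoint T)) (z : H) :
  adjoint_rel T (\val d) z -> adjoint T d = z.
Proof. by apply: adjoint_rel_uniq; exact: adjoint_funP. Qed.

Lemma adjoint_relD T (y z y' z' : H) : adjoint_rel T y z ->
  adjoint_rel T y' z' -> adjoint_rel T (y + y') (z + z').
Proof. by move=> yz yz' x; rewrite !linearDr/= yz yz'. Qed.

Lemma adjoint_rel_nullspace T (u : nullspace (adjoint T)) :
  adjoint_rel T (\val u) 0.
Proof. by apply/adjoint_graphP; exact: carrier_val u. Qed.

Lemma adjoint_pairC (S T : linop H) : adjoint_pair S T -> adjoint_pair T S.
Proof. by move=> ST x y; rewrite inner_conj -ST -inner_conj. Qed.

Lemma adjoint_pair_rel S T : adjoint_pair S T ->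
  forall y : dom T, adjoint_rel S (\val y) (T y).
Proof. by move=> ST y x; exact: ST. Qed.

Lemma inverse_adjoint_rel (S : linop H) T (V : {linear H -> H}) :
  extends S (adjoint T) -> bounded_inverse S V ->
  forall w, adjoint_rel T (V w) w.
Proof.
move=> ST [_ SV _] w; have [x <- <-] := SV w; have [y <- <-] := ST x.
exact: adjoint_funP.
Qed.

(** The hypothesis says that [V] is a right inverse of the adjoint. *)
Lemma adjoint_rel_inj T (V : {linear H -> H}) :
  (forall w, adjoint_rel T (V w) w) -> forall w, V w = 0 -> w = 0.
Proof.
move=> TV w w0; apply: (@adjoint_rel_uniq _ _ T 0); first by rewrite -w0.
by move=> x; rewrite !linear0r.
Qed.

(** Since [adjoint S] extends [T] and sends [V v] to [v], it acts on the
    decomposition of its domain by forgetting the kernel component. *)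
Lemma adjoint_rel_decomposition S T (V : {linear H -> H}) :
  adjoint_pair S T -> (forall w, adjoint_rel S (V w) w) ->
  forall (x0 : dom T) (v : H) (u : nullspace (adjoint S)),
    adjoint_rel S (\val x0 + V v + \val u) (T x0 + v).
Proof.
move=> ST SV x0 v u; rewrite -[T x0 + v]addr0.
by apply/adjoint_relD/adjoint_rel_nullspace/adjoint_relD => //;
  exact: adjoint_pair_rel.
Qed.

(** With u = T x for x = V u, both sides are values of the defining identity of
    the adjoint at x. This is what cancels the cross terms in Green's identity. *)
Lemma inner_inverse T (V W : {linear H -> H}) :
  bounded_inverse T V -> (forall w, adjoint_rel T (W w) w) ->
  forall u v : H, '[v, V u] = '[W v, u].
Proof.
move=> [_ TV _] TW u v; have [x <- {1}<-] := TV u.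
by rewrite [RHS]inner_conj (TW v x) -inner_conj.
Qed.

(** One half of Green's identity for the off-diagonal operator. The
    vectors [T x0 + v1] and [S y0 + u2] are the values of the adjoints given by
    [adjoint_rel_decomposition]; moving [T x0] and [S y0] across the inner
    product cancels all terms in which they occur. *)
Lemma green_adjoint_pair S T (V W : {linear H -> H}) :
    adjoint_pair S T ->
    (forall w, adjoint_rel S (W w) w) -> (forall w, adjoint_rel T (V w) w) ->
    (forall u v, '[v, V u] = '[W v, u]) ->
  forall (x0 : dom T) (y0 : dom S) (u1 : nullspace (adjoint S))
    (v2 : nullspace (adjoint T)) (v1 u2 : H),
  '[T x0 + v1, \val y0 + V u2 + \val v2] -
  '[\val x0 + W v1 + \val u1, S y0 + u2] =
  '[v1, \val v2 : H] - '[\val u1 : H, u2].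
Proof.
move=> ST SW TV VW x0 y0 u1 v2 v1 u2.
have TS := adjoint_pairC ST.
have Ty : '[T x0, \val y0 + V u2 + \val v2] = '[\val x0 : H, S y0 + u2].
  exact: (adjoint_rel_decomposition TS TV).
have Sx : '[\val x0 + W v1 + \val u1, S y0] = '[T x0 + v1, \val y0 : H].
  rewrite inner_conj [RHS]inner_conj; congr (_^*).
  exact: (adjoint_rel_decomposition ST SW).
rewrite [X in X - _]linearDl/= Ty [X in _ - X]linearDr/= Sx.
rewrite !(linearDl, linearDr)/= VW (TS x0 y0).
ring.
Qed.

End AdjointGraph.

(** * Coordinates of a direct sum *)

Section DirectSum.
Variables (C : numClosedFieldType) (H : hilbertType C).
Variables (D : set H) (U N M : lin_subspace H) (V : {linear H -> H}).

Hypothesis D_sum :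
  direct_sum3 D (carrier U) (V @` carrier N) (carrier M).

Lemma direct_sum_coordinates (x : H) : D x ->
  exists (x0 : U) (v : N) (u : M), x = \val x0 + V (\val v) + \val u.
Proof.
rewrite D_sum.1 => -[x0 [_ [u [Ux [v Nv <-] Mu ->]]]].
by exists (inV Ux), (inV Nv), (inV Mu).
Qed.

(** Directness only determines [V v]; injectivity of [V] then recovers [v]. *)
Lemma direct_sum_coordinates_inj (x x' : U) (v v' : N) (u u' : M) :
  (forall w, V w = 0 -> w = 0) ->
  \val x + V (\val v) + \val u = \val x' + V (\val v') + \val u' ->
  v = v' /\ u = u'.
Proof.
move=> Vinj E.
have [||||_ /Vinj v0 u0] := D_sum.2 (\val (x - x')) (V (\val (v - v')))
    (\val (u - u')).
- exact: carrier_val.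
- by exists (\val (v - v')) => //; exact: carrier_val.
- exact: carrier_val.
- transitivity ((\val x + V (\val v) + \val u) -
      (\val x' + V (\val v') + \val u')); last by rewrite E subrr.
  by rewrite !linearB/= !opprD [RHS]addrACA [X in _ = X + _]addrACA.
by split; apply/eqP; rewrite -subr_eq0; apply/eqP/val_inj; rewrite ?v0 ?u0 linear0.
Qed.

End DirectSum.

(** * The off-diagonal operator *)

Section Offdiag.
Variables (C : numClosedFieldType) (H : hilbertType C) (A B : dense_linop H).

Lemma offdiag_symmetric : adjoint_pair A B -> symmetric_op (offdiag A B).
Proof.
move=> AB p q; rewrite !inner_hsum/=.
rewrite (AB (offdiag2 p) (offdiag1 q)) addrC.
by rewrite (adjoint_pairC AB (offdiag1 p) (offdiag2 q)).
Qed.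

(** Testing against pairs with one vanishing entry separates the two
    conditions. *)
Lemma offdiag_adjoint_relP (x y z w : H) :
  adjoint_rel (offdiag A B) (x, y) (z, w) <->
  adjoint_rel A x w /\ adjoint_rel B y z.
Proof.
split=> [xy|[xw yz] p]; last first.
  by rewrite !inner_hsum/= (xw (offdiag2 p)) (yz (offdiag1 p)) addrC.
split=> [d|d].
  have D : carrier (dom (offdiag A B)) (0, \val d).
    by split; [exact: carrier0 | exact: carrier_val].
  have := xy (inV D); rewrite !inner_hsum/= linear0l add0r.
  have -> : offdiag1 (inV D) = 0 by apply: val_inj; rewrite linear0.
  have -> : offdiag2 (inV D) = d by exact: val_inj.
  by rewrite linear0 linear0l addr0.
have D : carrier (dom (offdiag A B)) (\val d, 0).
  by split; [exact: carrier_val | exact: carrier0].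
have := xy (inV D); rewrite !inner_hsum/= linear0l addr0.
have -> : offdiag2 (inV D) = 0 by apply: val_inj; rewrite linear0.
have -> : offdiag1 (inV D) = d by exact: val_inj.
by rewrite linear0 linear0l add0r.
Qed.

Lemma offdiag_adjoint_domP (x y : H) :
  carrier (dom (adjoint (offdiag A B))) (x, y) <->
  carrier (dom (adjoint A)) x /\ carrier (dom (adjoint B)) y.
Proof.
split=> [[[z w] /offdiag_adjoint_relP[xw yz]]|[[w xw] [z yz]]].
  by split; [exists w | exists z].
by exists (z, w); apply/offdiag_adjoint_relP.
Qed.

End Offdiag.

(** * Boundary components *)

Section Components.
Variables (C : numClosedFieldType) (H : hilbertType C) (A B : dense_linop H).
Variables (Ri Rsi : {linear H -> H}).

Local Notation NA := (nullspace (adjoint A)).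
Local Notation NB := (nullspace (adjoint B)).
Local Notation decomp := (decomposition A B Ri Rsi).

Lemma decompositionPl (a : C) (p q : hsum H H) (c d : (NA * NB) * (NA * NB)) :
  decomp p c -> decomp q d -> decomp (a *: p + q) (a *: c + d).
Proof.
have combine (x v u x' v' u' : H) : a *: (x + v + u) + (x' + v' + u') =
    (a *: x + x') + (a *: v + v') + (a *: u + u').
  by rewrite !scalerDr addrACA [X in X + _]addrACA.
move=> [x0 [y0 [px py]]] [x0' [y0' [qx qy]]].
exists (a *: x0 + x0'), (a *: y0 + y0'); split=> /=.
  by rewrite px qx combine linearP.
by rewrite py qy combine linearP.
Qed.

Hypothesis decomp_uniq : forall p : dom (adjoint (offdiag A B)),
  exists! c, decomp (\val p) c.

Local Notation comp p := (@components _ _ A B Ri Rsi (\val p)).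

Lemma components_decomposition (p : dom (adjoint (offdiag A B))) :
  decomp (\val p) (comp p).
Proof. by have [c [pc _]] := decomp_uniq p; exact: (xgetI _ pc). Qed.

Lemma components_eq (p : dom (adjoint (offdiag A B))) c :
  decomp (\val p) c -> comp p = c.
Proof.
have [d [_ dU]] := decomp_uniq p => pc.
by rewrite -(dU _ pc); apply/esym/dU/components_decomposition.
Qed.

(** A combination of decompositions is a decomposition of the combination, so
    uniqueness forces linearity although [components] is a choice. *)
Lemma components_linear (a : C) (p q : dom (adjoint (offdiag A B))) :
  comp (a *: p + q) = a *: comp p + comp q.
Proof.
apply: components_eq; rewrite sub_valPl.
by apply: decompositionPl; exact: components_decomposition.
Qed.

Lemma Gamma0E (p : dom (adjoint (offdiag A B))) :
  Gamma0 A B Ri Rsi p = ((comp p).1.1, (comp p).1.2).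
Proof. by rewrite /Gamma0; case: (components _ _ _) => -[? ?] []. Qed.

Lemma Gamma1E (p : dom (adjoint (offdiag A B))) :
  Gamma1 A B Ri Rsi p = ((comp p).2.1, - (comp p).2.2).
Proof. by rewrite /Gamma1; case: (components _ _ _) => -[? ?] []. Qed.

Lemma Gamma0_linear : linear (Gamma0 A B Ri Rsi).
Proof. by move=> a p q; rewrite !Gamma0E components_linear. Qed.

Lemma Gamma1_linear : linear (Gamma1 A B Ri Rsi).
Proof.
move=> a p q; rewrite !Gamma1E components_linear; congr (_, _) => /=.
by rewrite scalerN opprD.
Qed.

End Components.

Theorem theorem6 (F : realType) (H : hilbertType F[i])
  (A B : dense_linop H)
  (hAB : adjoint_pair A B)
  (hA : regular0 A) (hB : regular0 B)
  (R : dense_linop H) (Rinv Rsinv : {linear H -> H})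
  (hR : closed_op R)
  (hRinv : bounded_inverse R Rinv)
  (hRsinv : bounded_inverse (adjoint R) Rsinv)
  (hAR : extends A R) (hRB : extends R (adjoint B))
  (hBR : extends B (adjoint R)) (hRA : extends (adjoint R) (adjoint A))
  (hdomA : direct_sum3 (carrier (dom (adjoint A)))
     (carrier (dom B)) (Rsinv @` carrier (nullspace (adjoint B)))
     (carrier (nullspace (adjoint A))))
  (hdomB : direct_sum3 (carrier (dom (adjoint B)))
     (carrier (dom A)) (Rinv @` carrier (nullspace (adjoint A)))
     (carrier (nullspace (adjoint B)))) :
  [/\ symmetric_op (offdiag A B),
      (forall x y : H, carrier (dom (adjoint (offdiag A B))) (x, y) <->
         carrier (dom (adjoint A)) x /\ carrier (dom (adjoint B)) y),
      (forall (p : dom (adjoint (offdiag A B)))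
              (x : dom (adjoint A)) (y : dom (adjoint B)),
         \val p = (\val x, \val y) ->
         adjoint (offdiag A B) p = (adjoint B y, adjoint A x)),
      (forall p : dom (adjoint (offdiag A B)),
         exists! c, decomposition A B Rinv Rsinv (\val p) c) &
      boundary_triplet (Gamma0 A B Rinv Rsinv) (Gamma1 A B Rinv Rsinv)].
Proof.
have AR : forall w, adjoint_rel A (Rsinv w) w := inverse_adjoint_rel hRA hRsinv.
have BR : forall w, adjoint_rel B (Rinv w) w := inverse_adjoint_rel hRB hRinv.
have RR : forall u v, '[v, Rinv u] = '[Rsinv v, u].
  apply: (inner_inverse hRinv); apply: (inverse_adjoint_rel _ hRsinv).
  by move=> x; exists x.
have domP := @offdiag_adjoint_domP _ _ A B.
have actE (p : dom (adjoint (offdiag A B))) x y z w :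
    \val p = (x, y) -> adjoint_rel A x w -> adjoint_rel B y z ->
    adjoint (offdiag A B) p = (z, w).
  by move=> pE xw yz; apply: adjoint_eq; rewrite pE; apply/offdiag_adjoint_relP.
have decompU (p : dom (adjoint (offdiag A B))) :
    exists! c, decomposition A B Rinv Rsinv (\val p) c.
  have := carrier_val p; case: (\val p) => x y /domP[Dx Dy].
  have [x0 [v1 [u1 xE]]] := direct_sum_coordinates hdomA Dx.
  have [y0 [u2 [v2 yE]]] := direct_sum_coordinates hdomB Dy.
  exists ((u1, v1), (u2, v2)); split; first by exists x0, y0.
  move=> [[u1' v1'] [u2' v2']] [x0' [y0' /= [xE' yE']]].
  rewrite xE in xE'; rewrite yE in yE'.
  have [-> ->] := direct_sum_coordinates_inj hdomA (adjoint_rel_inj AR) xE'.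
  by have [-> ->] := direct_sum_coordinates_inj hdomB (adjoint_rel_inj BR) yE'.
split=> //.
- exact: offdiag_symmetric.
- by move=> p x y pE; apply: (actE _ _ _ _ _ pE); exact: adjoint_funP.
split.
- exact: Gamma0_linear.
- exact: Gamma1_linear.
- move=> p q; rewrite !Gamma0E !Gamma1E.
  have := components_decomposition decompU p.
  case: (components _ _ _) => -[u1 v1] [u2 v2] [x0 [y0 /= [px py]]].
  have := components_decomposition decompU q.
  case: (components _ _ _) => -[u1' v1'] [u2' v2'] [x0' [y0' /= [qx qy]]].
  rewrite !inner_hsum/= !inner_sub.
  have act (r : dom (adjoint (offdiag A B))) (x : dom B) (y : dom A)
      (u : nullspace (adjoint A)) (v : nullspace (adjoint B)) v' u' :
      (\val r).1 = \val x + Rsinv v' + \val u ->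
      (\val r).2 = \val y + Rinv u' + \val v ->
      adjoint (offdiag A B) r = (A y + u', B x + v').
    move=> rx ry; apply: (actE _ _ _ _ _ (surjective_pairing _)).
      by rewrite rx; exact: adjoint_rel_decomposition.
    rewrite ry; apply: adjoint_rel_decomposition => //; exact: adjoint_pairC.
  rewrite (act _ _ _ _ _ _ _ px py) (act _ _ _ _ _ _ _ qx qy) /= px py qx qy.
  (* The two halves: x with y', and y with x' after conjugation. *)
  have G := green_adjoint_pair hAB AR BR RR x0 y0' u1 v2' (\val v1) (\val u2').
  have G' := green_adjoint_pair hAB AR BR RR x0' y0 u1' v2 (\val v1') (\val u2).
  have {}G' := congr1 Num.conj G'.
  rewrite !rmorphB/= -!inner_conj in G'.
  rewrite linearNl linearN /=; move: G G' => /= G G'.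
  rewrite [X in X - _]addrC opprD addrACA G -[X in _ + X]opprB G'.
  ring.
- move=> [u1 v1] [u2 v2].
  pose x := Rsinv (\val v1) + \val u1 : H.
  (* The sign undoes the one in the second entry of Gamma1. *)
  pose y := Rinv (\val u2) + \val (- v2) : H.
  have Dxy : carrier (dom (adjoint (offdiag A B))) (x, y).
    apply/domP; split.
      by exists (\val v1 + 0); apply: adjoint_relD; [|exact: adjoint_rel_nullspace].
    by exists (\val u2 + 0); apply: adjoint_relD; [|exact: adjoint_rel_nullspace].
  exists (inV Dxy); rewrite Gamma0E Gamma1E.
  rewrite (components_eq decompU (c := ((u1, v1), (u2, - v2)))) /= ?opprK//.
  by exists 0, 0; rewrite !linear0 !add0r.
Qed.
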